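(* Let $F$ be a field of arbitrary characteristic and let $A$ be a (unital) commutative associative $F$-algebra which is a domain. Then the superalgebra $\Gamma(A)$ is a central order in the simple Jordan superalgebra of type $B(1,2)$ (the superalgebra of a skew-symmetric bilinear form on a 2-dimensional vector space). In particular, in this case $\Gamma(A)$ is prime and special.
   Context: $\Gamma(A)=A\oplus A^2$ is the $\mathbb Z_2$-graded algebra with even part $A$, odd part $A^2$, and multiplication extending that of $A$ by $a\cdot(b,c)=(b,c)\cdot a=(ab,ac)$, $(a,b)\cdot(c,d)=ad-bc$ for $a,b,c,d\in A$. It is a Jordan superalgebra, i.e. it is supercommutative ($xy=(-1)^{\bar x\bar y}yx$) and satisfies, for homogeneous elements, with $\bar x$ the parity of $x$ and $(x,y,z)=(xy)z-x(yz)$, the identity $(xy,z,t)+(-1)^{\bar y\bar z+\bar y\bar t+\bar z\bar t}(xt,z,y)+(-1)^{\bar x(\bar y+\bar z+\bar t)+\bar z\bar t}(yt,z,x)=0$. $B(1,2)$ over a field $K$ is the 3-dimensional superalgebra with even part $K\cdot1$ ($1$ the identity) and odd part $Kx+Ky$, $x^2=y^2=0$, $xy=-yx=1$. A superalgebra $\Gamma$ whose center $Z$ is a domain with nonzero elements acting injectively on $\Gamma$ is a central order in a superalgebra $S$ if the localization $(Z\setminus\{0\})^{-1}\Gamma$ is isomorphic to $S$. Here $S$ is $B(1,2)$ over the field of fractions $K$ of $A$. A superalgebra is prime if $IJ\ne0$ for any nonzero graded ideals $I,J$. A Jordan superalgebra is special (in the usual sense) if it embeds into a superalgebra of the form $R^{(+)}$,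 where $R$ is an associative superalgebra and $R^{(+)}$ is $R$ with product $a\circ b=\frac12(ab+(-1)^{\bar a\bar b}ba)$.
   Formalization: Speciality of Γ(A) is stated only when the characteristic of F is not 2, since the product of R^(+) involves 1/2 and is undefined in characteristic 2; the central order and primeness claims are in arbitrary characteristic. *)

(* Defs.v *)
From HB Require Import structures.
From mathcomp Require Import all_boot all_order all_algebra.
From mathcomp Require Import generic_quotient ring boolp.

Set Implicit Arguments.
Unset Strict Implicit.
Unset Printing Implicit Defensive.

Import GRing.Theory.
Local Open Scope ring_scope.
Local Open Scope quotient_scope.

#[short(type="idomainAlgType")]
HB.structure Definition IdomainAlgebra (F : fieldType) :=
  {A of GRing.IntegralDomain A & GRing.Algebra F A}.

(* The grading V = V_0 (+) V_1 is carried by the two projections [sa_pr false]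
   (even part) and [sa_pr true] (odd part); parities add by [addb]. *)
Record superalgebra (k : comNzRingType) := Superalgebra {
  sa_car :> lmodType k;
  sa_mul : sa_car -> sa_car -> sa_car;
  sa_pr : bool -> sa_car -> sa_car;
  sa_mul_linear : forall x, linear (sa_mul x);
  sa_mul_linearl : forall y, linear (fun x => sa_mul x y);
  sa_pr_linear : forall i, linear (sa_pr i);
  sa_pr_sum : forall x, x = sa_pr false x + sa_pr true x;
  sa_pr_pr : forall i j x, sa_pr i (sa_pr j x) = if i == j then sa_pr j x else 0;
  sa_mul_graded : forall i j x y,
    sa_pr (i (+) j) (sa_mul (sa_pr i x) (sa_pr j y))
      = sa_mul (sa_pr i x) (sa_pr j y)
}.

Notation "x ** y" := (sa_mul x y) (at level 40, left associativity) : ring_scope.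

Section SuperalgebraTheory.
Variables (k : comNzRingType) (G : superalgebra k).
Implicit Types (x y z t : G) (i j : bool).

Definition homog i x : Prop := sa_pr i x = x.

Definition assoc x y z : G := (x ** y) ** z - x ** (y ** z).

Definition associative_sa : Prop := forall x y z, assoc x y z = 0.

Definition supercommutative : Prop := forall (i j : bool) x y,
  homog i x -> homog j y -> x ** y = (-1) ^+ (i * j) *: (y ** x).

Definition jordan_identity : Prop := forall (a b c d : bool) x y z t,
  homog a x -> homog b y -> homog c z -> homog d t ->
  assoc (x ** y) z t
    + (-1) ^+ (b * c + b * d + c * d) *: assoc (x ** t) z y
    + (-1) ^+ (a * (b + c + d) + c * d) *: assoc (y ** t) z x = 0.

Definition jordan : Prop := supercommutative /\ jordan_identity.

Record graded_ideal (I : G -> Prop) : Prop := GradedIdeal {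
  gi0 : I 0;
  giD : forall x y, I x -> I y -> I (x + y);
  giZ : forall (a : k) x, I x -> I (a *: x);
  giMl : forall x y, I y -> I (x ** y);
  giMr : forall x y, I x -> I (x ** y);
  gi_pr : forall i x, I x -> I (sa_pr i x)
}.

Definition nonzero_set (I : G -> Prop) : Prop := exists2 x, I x & x <> 0.

Definition prime_sa : Prop := forall I J : G -> Prop,
  graded_ideal I -> graded_ideal J -> nonzero_set I -> nonzero_set J ->
  exists x y, [/\ I x, J y & x ** y <> 0].

Definition simple_sa : Prop :=
  (exists x y, x ** y <> 0) /\
  (forall I : G -> Prop, graded_ideal I -> nonzero_set I -> forall x, I x).

(* The second clause is [z, x]_s = 0 for all x, written out on homogeneous
   components so that z itself need not be homogeneous. *)
Definition central z : Prop :=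
  (forall x y, [/\ assoc z x y = 0, assoc x z y = 0 & assoc x y z = 0]) /\
  (forall (i j : bool) x,
     sa_pr i z ** sa_pr j x = (-1) ^+ (i * j) *: (sa_pr j x ** sa_pr i z)).

(* "The center is a domain whose nonzero elements act injectively".
   An odd central z satisfies 2 z^2 = 0, so [cd_even] follows from [cd_dom]
   as soon as 2 is invertible; without it the localization at the nonzero
   central elements would carry no grading. *)
Record center_domain : Prop := CenterDomain {
  cd_unit : exists e, [/\ central e, e <> 0 & forall z, central z -> e ** z = z];
  cd_dom : forall z w, central z -> central w -> z ** w = 0 -> z = 0 \/ w = 0;
  cd_even : forall z, central z -> homog false z;
  cd_inj : forall z, central z -> z <> 0 -> forall x, z ** x = 0 -> x = 0
}.

Lemma saMDr x y z : x ** (y + z) = x ** y + x ** z.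
Proof. by have := @sa_mul_linear k G x 1 y z; rewrite !scale1r. Qed.

Lemma saMDl x y z : (x + y) ** z = x ** z + y ** z.
Proof. by have := @sa_mul_linearl k G z 1 x y; rewrite !scale1r. Qed.

Lemma saM0 x : x ** 0 = 0.
Proof. by apply: (addrI (x ** 0)); rewrite -saMDr !addr0. Qed.

Lemma sa0M x : 0 ** x = 0.
Proof. by apply: (addrI (0 ** x)); rewrite -saMDl !addr0. Qed.

Lemma saMZr a x y : x ** (a *: y) = a *: (x ** y).
Proof. by have := @sa_mul_linear k G x a y 0; rewrite !addr0 saM0 addr0. Qed.

Lemma saMZl a x y : (a *: x) ** y = a *: (x ** y).
Proof. by have := @sa_mul_linearl k G y a x 0; rewrite !addr0 sa0M addr0. Qed.

Lemma saMN x y : x ** (- y) = - (x ** y).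
Proof. by apply: (addrI (x ** y)); rewrite -saMDr !subrr saM0. Qed.

Lemma sa_prD i x y : sa_pr i (x + y) = sa_pr i x + sa_pr i y.
Proof. by have := @sa_pr_linear k G i 1 x y; rewrite !scale1r. Qed.

Lemma sa_pr0 i : sa_pr i (0 : G) = 0.
Proof. by apply: (addrI (sa_pr i 0)); rewrite -sa_prD !addr0. Qed.

Lemma sa_prZ i a x : sa_pr i (a *: x) = a *: sa_pr i x.
Proof. by have := @sa_pr_linear k G i a x 0; rewrite !addr0 sa_pr0 addr0. Qed.

End SuperalgebraTheory.

Definition is_hom (k : comNzRingType) (G H : superalgebra k)
    (f : {linear G -> H}) : Prop :=
  (forall x y, f (x ** y) = f x ** f y) /\
  (forall i x, f (sa_pr i x) = sa_pr i (f x)).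

Definition isomorphic (k : comNzRingType) (G H : superalgebra k) : Prop :=
  exists2 f : {linear G -> H}, bijective f & is_hom f.

(* (Z \ {0})^{-1} G, as classes of pairs (x, s) standing for s^{-1} x.    *)

Section Localization.
Variables (k : comNzRingType) (G : superalgebra k) (hG : center_domain G).
Implicit Types (x y z : G).

Definition denom : choiceType := {z : G | `[< central z /\ z <> 0 >]}.
Implicit Types (s t r : denom).

Lemma denom_central s : central (val s).
Proof. by case: s => z /= /asboolP[]. Qed.

Lemma denom_neq0 s : val s <> 0.
Proof. by case: s => z /= /asboolP[]. Qed.

Lemma denom_inj s x y : val s ** x = val s ** y -> x = y.
Proof.
move=> e; apply/eqP; rewrite -subr_eq0; apply/eqP.
apply: (cd_inj hG (denom_central s) (@denom_neq0 s)).
by rewrite saMDr saMN e subrr.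
Qed.

Lemma central_mulA z x y : central z -> (z ** x) ** y = z ** (x ** y).
Proof. by case=> /(_ x y)[/eqP + _ _] _; rewrite subr_eq0 => /eqP. Qed.

Lemma central_mulAr z x y : central z -> (x ** z) ** y = x ** (z ** y).
Proof. by case=> /(_ x y)[_ /eqP + _] _; rewrite subr_eq0 => /eqP. Qed.

Lemma central_mulAm z x y : central z -> (x ** y) ** z = x ** (y ** z).
Proof. by case=> /(_ x y)[_ _ /eqP +] _; rewrite subr_eq0 => /eqP. Qed.

Lemma central_mulC z x : central z -> z ** x = x ** z.
Proof.
move=> cz; have ez := cd_even hG cz; case: cz => _ /(_ false).
rewrite ez => h; rewrite (sa_pr_sum x) saMDr saMDl.
by rewrite !h !mul0n !expr0 !scale1r.
Qed.

Lemma central_mulCA z x y : central z -> x ** (z ** y) = z ** (x ** y).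
Proof.
by move=> cz; rewrite -(central_mulAr _ _ cz) -(central_mulC _ cz) (central_mulA _ _ cz).
Qed.

Lemma central_mul z w : central z -> central w -> central (z ** w).
Proof.
move=> cz cw; split=> [x y|i j x].
  split; rewrite /assoc.
  - by rewrite !(central_mulA _ _ cz) !(central_mulA _ _ cw) subrr.
  - rewrite (central_mulA _ _ cz) !(central_mulCA _ _ cz) (central_mulA _ _ cz).
    by rewrite (central_mulAr _ _ cw) subrr.
  - by rewrite !(central_mulCA _ _ cz) (central_mulAm _ _ cw) subrr.
have ezw : sa_pr false (z ** w) = z ** w.
  have := sa_mul_graded false false z w.
  by rewrite (cd_even hG cz) (cd_even hG cw).
case: i => /=.
  have -> : sa_pr true (z ** w) = 0 by rewrite -ezw sa_pr_pr.
  by rewrite sa0M saM0 scaler0.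
rewrite ezw mul0n expr0 scale1r (central_mulA _ _ cz) (central_mulC _ cw).
by rewrite -(central_mulA _ _ cz) (central_mulC _ cz) central_mulAr.
Qed.

Definition Denom z (p : `[< central z /\ z <> 0 >]) : denom :=
  exist (fun z => `[< central z /\ z <> 0 >]) z p.

Lemma denom_mul_subproof s t :
  `[< central (val s ** val t) /\ val s ** val t <> 0 >].
Proof.
apply/asboolP; split; first exact: central_mul (denom_central s) (denom_central t).
by move=> /(cd_inj hG (denom_central s) (@denom_neq0 s))/denom_neq0.
Qed.

Definition denom_mul s t : denom := Denom (denom_mul_subproof s t).

Lemma denom1_subproof : exists s : denom, True.
Proof.
have [e [ce e0 _]] := cd_unit hG.
have p : `[< central e /\ e <> 0 >] by apply/asboolP.
by exists (Denom p).
Qed.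

Definition denom1 : denom := projT1 (cid denom1_subproof).

Definition frac_eq (u v : G * denom) : bool := val v.2 ** u.1 == val u.2 ** v.1.

Lemma frac_eq_refl : reflexive frac_eq.
Proof. by move=> u; rewrite /frac_eq. Qed.

Lemma frac_eq_sym : symmetric frac_eq.
Proof. by move=> u v; rewrite /frac_eq eq_sym. Qed.

Lemma frac_eq_trans : transitive frac_eq.
Proof.
move=> [y t] [x s] [z r]; rewrite /frac_eq /= => /eqP xy /eqP yz.
apply/eqP/(@denom_inj t).
rewrite (central_mulCA _ _ (denom_central r)) xy.
rewrite (central_mulCA _ _ (denom_central s)) yz.
by rewrite (central_mulCA _ _ (denom_central s)).
Qed.

Canonical frac_equiv := EquivRel frac_eq frac_eq_refl frac_eq_sym frac_eq_trans.

Definition loc_type := {eq_quot frac_eq}.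
HB.instance Definition _ : EqQuotient _ frac_eq loc_type := EqQuotient.on loc_type.
HB.instance Definition _ := Choice.on loc_type.

Definition frac x s : loc_type := \pi_loc_type (x, s).

Lemma fracE x s y t : val t ** x = val s ** y -> frac x s = frac y t.
Proof. by move=> e; apply/eqmodP/eqP. Qed.

Lemma fracP x s y t : frac x s = frac y t -> val t ** x = val s ** y.
Proof. by move/eqmodP/eqP. Qed.

Lemma fracW (P : loc_type -> Prop) : (forall x s, P (frac x s)) -> forall q, P q.
Proof. by move=> h; elim/quotW => -[x s]; apply: h. Qed.

Lemma frac_expand x s t : frac x s = frac (val t ** x) (denom_mul t s).
Proof.
by apply: fracE; rewrite (central_mulA _ _ (denom_central t)) central_mulCA //;
  apply: denom_central.
Qed.

Lemma frac_common2 (P : loc_type -> loc_type -> Prop) :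
  (forall x y s, P (frac x s) (frac y s)) -> forall p q, P p q.
Proof.
move=> h; elim/fracW => x s; elim/fracW => y t.
rewrite (frac_expand x s t) (frac_expand y t s).
suff -> : denom_mul s t = denom_mul t s by apply: h.
by apply: val_inj; apply: central_mulC; apply: denom_central.
Qed.

Lemma frac_common3 (P : loc_type -> loc_type -> loc_type -> Prop) :
  (forall x y z s, P (frac x s) (frac y s) (frac z s)) -> forall p q p', P p q p'.
Proof.
move=> h p q p'; move: p q; apply: frac_common2 => x y s.
elim/fracW: p' => z t.
rewrite (frac_expand x s t) (frac_expand y s t) (frac_expand z t s).
suff -> : denom_mul s t = denom_mul t s by apply: h.
by apply: val_inj; apply: central_mulC; apply: denom_central.
Qed.

Definition loc_add (p q : loc_type) : loc_type :=
  let: (x, s) := repr p in let: (y, t) := repr q in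
  frac (val t ** x + val s ** y) (denom_mul s t).
Definition loc_zero : loc_type := frac 0 denom1.
Definition loc_opp (p : loc_type) : loc_type :=
  let: (x, s) := repr p in frac (- x) s.
Definition loc_scale (a : k) (p : loc_type) : loc_type :=
  let: (x, s) := repr p in frac (a *: x) s.
Definition loc_mul (p q : loc_type) : loc_type :=
  let: (x, s) := repr p in let: (y, t) := repr q in
  frac (x ** y) (denom_mul s t).
Definition loc_pr (i : bool) (p : loc_type) : loc_type :=
  let: (x, s) := repr p in frac (sa_pr i x) s.

Lemma repr_frac x s y t : repr (frac x s) = (y, t) -> val s ** y = val t ** x.
Proof.
by move=> e; apply: fracP; rewrite [LHS]/frac -e reprK.
Qed.

Let cA s := fun x y => central_mulA x y (denom_central s).
Let cCA s := fun x y => @central_mulCA (val s) x y (denom_central s).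
Let cC s := fun x => @central_mulC (val s) x (denom_central s).

Lemma loc_addE x y s : loc_add (frac x s) (frac y s) = frac (x + y) s.
Proof.
rewrite /loc_add.
case e1: (repr (frac x s)) => [x' t]; case e2: (repr (frac y s)) => [y' r].
move: e1 e2 => /repr_frac e1 /repr_frac e2.
apply: fracE => /=.
rewrite (cA t) !saMDr (cCA r (val s) x') e1 (cCA t (val s) y') e2.
by rewrite (cCA t (val r) x).
Qed.

Lemma loc_oppE x s : loc_opp (frac x s) = frac (- x) s.
Proof.
rewrite /loc_opp; case e1: (repr (frac x s)) => [x' t].
by apply: fracE => /=; rewrite !saMN (repr_frac e1).
Qed.

Lemma loc_scaleE a x s : loc_scale a (frac x s) = frac (a *: x) s.
Proof.
rewrite /loc_scale; case e1: (repr (frac x s)) => [x' t].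
by apply: fracE => /=; rewrite !saMZr (repr_frac e1).
Qed.

Lemma loc_mulE x s y t :
  loc_mul (frac x s) (frac y t) = frac (x ** y) (denom_mul s t).
Proof.
rewrite /loc_mul.
case e1: (repr (frac x s)) => [x' s']; case e2: (repr (frac y t)) => [y' t'].
move: e1 e2 => /repr_frac e1 /repr_frac e2.
apply: fracE => /=; rewrite (cA s) (cA s').
rewrite -(cCA t x' y') e2 (cCA t' x' y) (cCA t' (val s)) -(cA s x' y) e1.
by rewrite (cA s' x y) (cCA t' (val s')).
Qed.

Lemma central_pr z i x : central z -> sa_pr i (z ** x) = z ** sa_pr i x.
Proof.
move=> cz; have ez := cd_even hG cz.
have h j : sa_pr j (z ** sa_pr j x) = z ** sa_pr j x.
  by have := sa_mul_graded false j z x; rewrite ez addFb.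
rewrite {1}(sa_pr_sum x) saMDr sa_prD -(h false) -(h true) !sa_pr_pr.
by case: i => /=; rewrite ?add0r ?addr0 h.
Qed.

Lemma loc_prE i x s : loc_pr i (frac x s) = frac (sa_pr i x) s.
Proof.
rewrite /loc_pr; case e1: (repr (frac x s)) => [x' t].
apply: fracE => /=; rewrite -!central_pr ?(repr_frac e1) //; exact: denom_central.
Qed.

Lemma loc_zeroE s : loc_zero = frac 0 s.
Proof. by apply: fracE; rewrite !saM0. Qed.

Lemma loc_addA : associative loc_add.
Proof. by apply: frac_common3 => x y z s; rewrite !loc_addE addrA. Qed.

Lemma loc_addC : commutative loc_add.
Proof. by apply: frac_common2 => x y s; rewrite !loc_addE addrC. Qed.

Lemma loc_add0 : left_id loc_zero loc_add.
Proof. by elim/fracW => x s; rewrite (loc_zeroE s) loc_addE add0r. Qed.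

Lemma loc_addN : left_inverse loc_zero loc_opp loc_add.
Proof. by elim/fracW => x s; rewrite loc_oppE loc_addE addNr -loc_zeroE. Qed.

HB.instance Definition _ :=
  GRing.isZmodule.Build loc_type loc_addA loc_addC loc_add0 loc_addN.

Lemma loc_scaleA a b p : loc_scale a (loc_scale b p) = loc_scale (a * b) p.
Proof. by elim/fracW: p => x s; rewrite !loc_scaleE scalerA. Qed.

Lemma loc_scale1 : left_id 1 loc_scale.
Proof. by elim/fracW => x s; rewrite loc_scaleE scale1r. Qed.

Lemma loc_scaleDr : right_distributive loc_scale +%R.
Proof.
move=> a; apply: frac_common2 => x y s; rewrite !loc_scaleE.
by rewrite /GRing.add /= !loc_addE loc_scaleE scalerDr.
Qed.

Lemma loc_scaleDl p : {morph loc_scale^~ p : a b / a + b}.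
Proof.
move=> a b; elim/fracW: p => x s; rewrite !loc_scaleE.
by rewrite [RHS]/GRing.add /= !loc_addE scalerDl.
Qed.

HB.instance Definition _ := GRing.Zmodule_isLmodule.Build k loc_type
  loc_scaleA loc_scale1 loc_scaleDr loc_scaleDl.

Lemma frac_add x y s : frac x s + frac y s = frac (x + y) s.
Proof. exact: loc_addE. Qed.

Lemma frac_scale a x s : a *: frac x s = frac (a *: x) s.
Proof. exact: loc_scaleE. Qed.

Lemma frac0 s : frac 0 s = 0.
Proof. by rewrite -loc_zeroE. Qed.

Lemma loc_mul_linear p : linear (loc_mul p).
Proof.
move=> a; elim/fracW: p => z t; apply: frac_common2 => x y s.
by rewrite !(frac_scale, frac_add, loc_mulE) saMDr saMZr.
Qed.

Lemma loc_mul_linearl p : linear (fun q => loc_mul q p).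
Proof.
move=> a; elim/fracW: p => z t; apply: frac_common2 => x y s.
by rewrite !(frac_scale, frac_add, loc_mulE) saMDl saMZl.
Qed.

Lemma loc_pr_linear i : linear (loc_pr i).
Proof.
move=> a; apply: frac_common2 => x y s.
by rewrite !(frac_scale, frac_add, loc_prE) sa_prD sa_prZ.
Qed.

Lemma loc_pr_sum p : p = loc_pr false p + loc_pr true p.
Proof. by elim/fracW: p => x s; rewrite !loc_prE frac_add -sa_pr_sum. Qed.

Lemma loc_pr_pr i j p : loc_pr i (loc_pr j p) = if i == j then loc_pr j p else 0.
Proof.
by elim/fracW: p => x s; rewrite !loc_prE sa_pr_pr; case: eqP => // _; apply: frac0.
Qed.

Lemma loc_mul_graded i j p q :
  loc_pr (i (+) j) (loc_mul (loc_pr i p) (loc_pr j q))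
    = loc_mul (loc_pr i p) (loc_pr j q).
Proof.
by elim/fracW: p => x s; elim/fracW: q => y t; rewrite !(loc_prE, loc_mulE) sa_mul_graded.
Qed.

Definition localization : superalgebra k := Superalgebra
  loc_mul_linear loc_mul_linearl loc_pr_linear loc_pr_sum loc_pr_pr loc_mul_graded.

End Localization.

Definition central_order (k : comNzRingType) (G S : superalgebra k) : Prop :=
  exists hG : center_domain G, isomorphic (localization hG) S.


Section RestrictScalars.
Variables (k K : comNzRingType) (phi : {rmorphism k -> K}).

Definition restr_type (V : lmodType K) : Type := V.

Section Module.
Variable V : lmodType K.
HB.instance Definition _ := GRing.Zmodule.on (restr_type V).

Let rscale (a : k) (v : restr_type V) : restr_type V := phi a *: (v : V).

Lemma rscaleA a b v : rscale a (rscale b v) = rscale (a * b) v.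
Proof. by rewrite /rscale scalerA rmorphM. Qed.
Lemma rscale1 : left_id 1 rscale.
Proof. by move=> v; rewrite /rscale rmorph1 scale1r. Qed.
Lemma rscaleDr : right_distributive rscale +%R.
Proof. by move=> a u v; rewrite /rscale scalerDr. Qed.
Lemma rscaleDl v : {morph rscale^~ v : a b / a + b}.
Proof. by move=> a b; rewrite /rscale rmorphD scalerDl. Qed.

HB.instance Definition _ := GRing.Zmodule_isLmodule.Build k (restr_type V)
  rscaleA rscale1 rscaleDr rscaleDl.
End Module.

Variable S : superalgebra K.
Let V : lmodType k := restr_type S.

Lemma restr_linear (f : S -> S) : linear f -> linear (f : V -> V).
Proof. by move=> lf a x y; apply: (lf (phi a)). Qed.

Definition restrict_scalars : superalgebra k :=
  @Superalgebra k V (@sa_mul K S) (@sa_pr K S)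
    (fun x => restr_linear (@sa_mul_linear K S x))
    (fun y => restr_linear (@sa_mul_linearl K S y))
    (fun i => restr_linear (@sa_pr_linear K S i))
    (@sa_pr_sum K S) (@sa_pr_pr K S) (@sa_mul_graded K S).
End RestrictScalars.


Section Gamma.
Variables (F : comNzRingType) (A : comAlgType F).

Definition gamma_type : lmodType F := (A * (A * A))%type.
Implicit Types u v : gamma_type.

Definition gamma_mul u v : gamma_type :=
  let: (a, (b, c)) := u in let: (a', (b', c')) := v in
  (a * a' + (b * c' - c * b'), (a * b' + a' * b, a * c' + a' * c)).

Definition gamma_pr (i : bool) u : gamma_type :=
  if i then (0, u.2) else (u.1, 0).

Lemma gamma_ext u v : u.1 = v.1 -> u.2.1 = v.2.1 -> u.2.2 = v.2.2 -> u = v.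
Proof. by case: u v => a [b c] [a' [b' c']] /= -> -> ->. Qed.

Lemma gamma_mul_linear u : linear (gamma_mul u).
Proof.
case: u => a [b c] r [a1 [b1 c1]] [a2 [b2 c2]].
have [d dE] : exists d : A, forall x, r *: x = d * x.
  by exists r%:A => x; rewrite mulr_algl.
by apply: gamma_ext; rewrite /= !dE; ring.
Qed.

Lemma gamma_mul_linearl v : linear (fun u => gamma_mul u v).
Proof.
case: v => a [b c] r [a1 [b1 c1]] [a2 [b2 c2]].
have [d dE] : exists d : A, forall x, r *: x = d * x.
  by exists r%:A => x; rewrite mulr_algl.
by apply: gamma_ext; rewrite /= !dE; ring.
Qed.

Lemma gamma_pr_linear i : linear (gamma_pr i).
Proof.
case: i => r [a1 [b1 c1]] [a2 [b2 c2]];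
by apply: gamma_ext; rewrite /= ?scaler0 ?addr0.
Qed.

Lemma gamma_pr_sum u : u = gamma_pr false u + gamma_pr true u.
Proof. by case: u => a [b c]; apply: gamma_ext; rewrite /= ?addr0 ?add0r. Qed.

Lemma gamma_pr_pr i j u : gamma_pr i (gamma_pr j u) = if i == j then gamma_pr j u else 0.
Proof. by case: i j => -[]. Qed.

Lemma gamma_mul_graded i j u v :
  gamma_pr (i (+) j) (gamma_mul (gamma_pr i u) (gamma_pr j v))
    = gamma_mul (gamma_pr i u) (gamma_pr j v).
Proof.
case: u v => a [b c] [a' [b' c']].
by case: i j => -[]; apply: gamma_ext; rewrite /=; ring.
Qed.

Definition Gamma : superalgebra F := Superalgebra gamma_mul_linear
  gamma_mul_linearl gamma_pr_linear gamma_pr_sum gamma_pr_pr gamma_mul_graded.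

Lemma Gamma_jordan : jordan Gamma.
Proof.
split=> [i j x y <- <-|i j l m x y z t <- <- <- <-].
  case: x y => a [b c] [a' [b' c']]; rewrite -signr_odd.
  by case: i j => -[]; apply: gamma_ext; rewrite /= ?(expr0, expr1, scale1r, scaleN1r) /=; ring.
case: x y z t => a [b c] [a' [b' c']] [p [q r]] [p' [q' r']].
rewrite -signr_odd -[in X in _ + X](signr_odd _ (i * _ + _)).
case: i j l m => -[] [] []; apply: gamma_ext; rewrite /= ?(expr0, expr1, scale1r, scaleN1r) /=; ring.
Qed.

End Gamma.

(* The superalgebra K.1 (+) V of a skew-symmetric bilinear form on V = K^2. *)

Section B12.
Variable K : fieldType.

Definition b12_type : lmodType K := (K^o * 'rV[K]_2)%type.
Implicit Types u v : b12_type.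

Definition b12_form (p q : 'rV[K]_2) : K :=
  p 0 0 * q 0 1 - p 0 1 * q 0 0.

Definition b12_mul u v : b12_type :=
  (u.1 * v.1 + b12_form u.2 v.2, (u.1 : K) *: v.2 + (v.1 : K) *: u.2).

Definition b12_pr (i : bool) u : b12_type :=
  if i then (0, u.2) else (u.1, 0).

Lemma b12_form0r p : b12_form p 0 = 0.
Proof. by rewrite /b12_form !mxE !mulr0 subrr. Qed.

Lemma b12_form0l p : b12_form 0 p = 0.
Proof. by rewrite /b12_form !mxE !mul0r subrr. Qed.

Lemma b12_ext u v : u.1 = v.1 -> u.2 = v.2 -> u = v.
Proof. by case: u v => a p [b q] /= -> ->. Qed.

Lemma b12_mul_linear u : linear (b12_mul u).
Proof.
case: u => a p r [b q] [c s]; apply: b12_ext; rewrite /b12_form /=.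
  rewrite /b12_form !mxE /GRing.scale /=; ring.
by apply/rowP => i; rewrite !mxE /GRing.scale /=; ring.
Qed.

Lemma b12_mul_linearl v : linear (fun u => b12_mul u v).
Proof.
case: v => a p r [b q] [c s]; apply: b12_ext; rewrite /b12_form /=.
  rewrite /b12_form !mxE /GRing.scale /=; ring.
by apply/rowP => i; rewrite !mxE /GRing.scale /=; ring.
Qed.

Lemma b12_pr_linear i : linear (b12_pr i).
Proof.
by case: i => r [b q] [c s]; apply: b12_ext; rewrite /= ?scaler0 ?addr0.
Qed.

Lemma b12_pr_sum u : u = b12_pr false u + b12_pr true u.
Proof. by case: u => a p; apply: b12_ext; rewrite /= ?addr0 ?add0r. Qed.

Lemma b12_pr_pr i j u : b12_pr i (b12_pr j u) = if i == j then b12_pr j u else 0.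
Proof. by case: i j => -[]. Qed.

Lemma b12_mul_graded i j u v :
  b12_pr (i (+) j) (b12_mul (b12_pr i u) (b12_pr j v))
    = b12_mul (b12_pr i u) (b12_pr j v).
Proof.
case: u v => a p [b q]; case: i j => -[]; apply: b12_ext;
  by rewrite /= ?(b12_form0r, b12_form0l, scale0r, scaler0, mul0r, mulr0, addr0, add0r).
Qed.

Definition B12 : superalgebra K := Superalgebra b12_mul_linear
  b12_mul_linearl b12_pr_linear b12_pr_sum b12_pr_pr b12_mul_graded.

Definition b12_one : B12 := (1, 0).
Definition b12_x : B12 := (0, delta_mx 0 0).
Definition b12_y : B12 := (0, delta_mx 0 1).

Lemma b12_table :
  [/\ b12_x ** b12_x = 0, b12_y ** b12_y = 0,
      b12_x ** b12_y = b12_one, b12_y ** b12_x = - b12_one &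
      forall u : B12, b12_one ** u = u /\ u ** b12_one = u].
Proof.
split; last (move=> [a p]; split); apply: b12_ext;
  rewrite /= ?scale0r ?scaler0 ?scale1r ?addr0 ?add0r ?oppr0 //;
  rewrite /b12_form /= ?mxE ?eqxx /=; ring.
Qed.

Lemma b12_basis (u : B12) :
  u = (u.1 : K) *: b12_one + u.2 0 0 *: b12_x + u.2 0 1 *: b12_y.
Proof.
case: u => a p; apply: b12_ext; first by rewrite /= !scaler0 !addr0 /GRing.scale /= mulr1.
apply/rowP => i; rewrite !mxE /= mulr0 add0r.
by case: i => -[|[|//]] p2; rewrite ?(mulr0, mulr1, addr0, add0r); congr (p _ _); apply: val_inj.
Qed.

End B12.

(* R^(+) is meaningful only when 2 != 0 in F: MathComp's 2^-1 is 0 otherwise. *)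

Section Plus.
Variables (F : fieldType) (R : superalgebra F).
Implicit Types a b : R.

Definition plus_mul a b : R := (2%:R : F)^-1 *:
  \sum_(i : bool) \sum_(j : bool)
    (sa_pr i a ** sa_pr j b + (-1) ^+ (i * j) *: (sa_pr j b ** sa_pr i a)).

Lemma plus_mul_linear a : linear (plus_mul a).
Proof.
move=> r b c; rewrite /plus_mul scalerA mulrC -scalerA -scalerDr; congr (_ *: _).
rewrite scaler_sumr -big_split; apply: eq_bigr => i _ /=.
rewrite scaler_sumr -big_split; apply: eq_bigr => j _ /=.
rewrite sa_prD sa_prZ !(saMDr, saMDl, saMZr, saMZl) !scalerDr !scalerA.
by rewrite [r * _]mulrC addrACA.
Qed.

Lemma plus_mul_linearl b : linear (fun a => plus_mul a b).
Proof.
move=> r a c; rewrite /plus_mul scalerA mulrC -scalerA -scalerDr; congr (_ *: _).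
rewrite scaler_sumr -big_split; apply: eq_bigr => i _ /=.
rewrite scaler_sumr -big_split; apply: eq_bigr => j _ /=.
rewrite sa_prD sa_prZ !(saMDr, saMDl, saMZr, saMZl) !scalerDr !scalerA.
by rewrite [r * _]mulrC addrACA.
Qed.

Lemma plus_mul_homog i j a b :
  plus_mul (sa_pr i a) (sa_pr j b) = (2%:R : F)^-1 *:
    (sa_pr i a ** sa_pr j b + (-1) ^+ (i * j) *: (sa_pr j b ** sa_pr i a)).
Proof.
rewrite /plus_mul (bigD1 i) //= (bigD1 j) //= !sa_pr_pr !eqxx.
rewrite !big1 ?addr0 // => [i' /negPf ni|j' /negPf nj].
  by apply: big1 => j' _; rewrite sa_pr_pr ni sa0M saM0 scaler0 addr0.
by rewrite sa_pr_pr nj sa0M saM0 scaler0 addr0.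
Qed.

Lemma plus_mul_graded i j a b :
  sa_pr (i (+) j) (plus_mul (sa_pr i a) (sa_pr j b))
    = plus_mul (sa_pr i a) (sa_pr j b).
Proof.
rewrite plus_mul_homog sa_prZ sa_prD sa_prZ sa_mul_graded.
by rewrite [in X in _ + _ *: X]addbC sa_mul_graded.
Qed.

Definition plus_sa : superalgebra F := Superalgebra plus_mul_linear
  plus_mul_linearl (@sa_pr_linear F R) (@sa_pr_sum F R) (@sa_pr_pr F R)
  plus_mul_graded.

End Plus.

Definition special (F : fieldType) (J : superalgebra F) : Prop :=
  exists2 R : superalgebra F, associative_sa R &
    exists2 f : {linear J -> plus_sa R}, injective f & is_hom f.

(* Main.v *)
Require Import Defs.
From HB Require Import structures.
From mathcomp Require Import all_boot all_order all_algebra.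
From mathcomp Require Import ring boolp functions generic_quotient.

Set Implicit Arguments.
Unset Strict Implicit.
Unset Printing Implicit Defensive.

Import GRing.Theory.
Local Open Scope ring_scope.

(** Over a field K, taking coordinates with respect to the basis 1, x, y
identifies B(1,2) with Gamma(K): the form on K^2 is (b, c), (b', c') |->
bc' - cb' on both sides.  Hence B(1,2) inherits the Jordan identities of Gamma,
and it is simple because every nonzero homogeneous element can be multiplied
into a nonzero multiple of 1: an odd vector by x or y, as the form is
nondegenerate.

The centre of Gamma(A) is A itself (lemma gamma_central).  For an odd part
(b, c), associating it with the basis vectors e1, e2 of A^2 produces -b and c,
so centrality kills it; this uses no division by 2 and hence works in every
characteristic.  If A is a domain, A acts on Gamma(A) = A^3 by multiplication of
the coordinates, so the centre is a domain acting injectively.  Inverting A \ 0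
turns A^3 into K^3 with K = Frac A: the map sending the fraction u / s to
s^-1 *: u, with u embedded in B(1,2) coordinate by coordinate, is the required
isomorphism; it is onto because three fractions have a common denominator.

For primeness, every nonzero graded ideal of Gamma(A) meets A nontrivially, by
the argument used for simplicity, and A has no zero divisors.

Speciality comes from the Weyl algebra.  Let X and Y be operators with
XY - YX = 2.  Then in the plus algebra of a superalgebra where X and Y are odd,
X.X = Y.Y = 0 and X.Y = (XY - YX)/2 = 1, which are the relations of Gamma(A).
Concretely X = 2 d/dt and Y = multiplication by t, acting on the formal power
series over A, graded by the parity of the exponents; the associative envelope
is the superalgebra of all linear endomorphisms of that graded module (End_sa).
An operator a + bX + cY determines a, b, c, since its values on 1 and t show
a, c and 2b. *)

(** * The superalgebra B(1,2) is Jordan and simple *)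

(** The Jordan identities are universally quantified equations, so they pass to
subalgebras. *)
Lemma jordan_of_embedding (k : comNzRingType) (G H : superalgebra k)
    (f : {linear G -> H}) :
  injective f -> is_hom f -> jordan H -> jordan G.
Proof.
move=> f_inj [fM f_pr] [scH jH].
have f_homog i x : homog i x -> homog i (f x) by rewrite /homog -f_pr => ->.
have f_assoc x y z : f (assoc x y z) = assoc (f x) (f y) (f z).
  by rewrite /assoc linearB !fM.
split=> [i j x y hx hy|a b c d x y z t hx hy hz ht]; apply: f_inj.
  by rewrite linearZ_LR !fM; apply: scH; apply: f_homog.
rewrite linear0 2!linearD !linearZ_LR !f_assoc !fM.
by apply: jH; apply: f_homog.
Qed.

Section JordanSimple.
Variable K : fieldType.

Definition b12_coords (u : B12 K) : Gamma K^o := (u.1, (u.2 0 0, u.2 0 1)).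

Lemma b12_coords_linear : linear b12_coords.
Proof. by move=> a [b q] [c s]; apply: gamma_ext; rewrite /= ?mxE. Qed.

HB.instance Definition _ :=
  GRing.isLinear.Build K (B12 K) (Gamma K^o) *:%R b12_coords b12_coords_linear.

Lemma b12_coords_inj : injective b12_coords.
Proof.
move=> u v [e1 e2 e3].
by rewrite (b12_basis u) (b12_basis v) e1 e2 e3.
Qed.

Lemma b12_coords_hom : is_hom b12_coords.
Proof.
split=> [[a q] [b s]|i [a q]]; last by case: i; apply: gamma_ext; rewrite /= ?mxE.
by apply: gamma_ext; rewrite /= /b12_form ?mxE //; ring.
Qed.

Lemma B12_jordan : jordan (B12 K).
Proof. exact: jordan_of_embedding b12_coords_inj b12_coords_hom (Gamma_jordan K^o). Qed.

Lemma B12_one_mul (u : B12 K) : b12_one K ** u = u.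
Proof. by have [_ _ _ _ /(_ u)[]] := b12_table K. Qed.

(** A nonzero multiple of the identity can be divided back to the identity,
because ideals are closed under scaling by K. *)
Lemma B12_ideal_scalar (I : B12 K -> Prop) (a : K) :
  graded_ideal I -> a != 0 -> I (a *: b12_one K) -> forall u, I u.
Proof.
move=> hI a0 /(giZ hI a^-1); rewrite scalerA mulVf // scale1r => I1 u.
by rewrite -(B12_one_mul u); apply: giMr.
Qed.

(** A nonzero even part is already a multiple of 1; a purely odd element is
multiplied by x or y to extract its y- or x-coordinate. *)
Lemma B12_simple : simple_sa (B12 K).
Proof.
split; first exists (b12_one K), (b12_one K).
  by rewrite B12_one_mul => -[/eqP]; rewrite oner_eq0.
move=> I hI [u Iu u0].
have [a0|a0] := eqVneq (u.1 : K) 0; last first.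
  apply: (B12_ideal_scalar hI a0).
  have := gi_pr hI false Iu; congr I; apply: b12_ext => /=.
    by rewrite /GRing.scale /= mulr1.
  by rewrite scaler0.
have mulx : u ** b12_x K = - u.2 0 1 *: b12_one K.
  rewrite {1}(b12_basis u) a0 scale0r add0r saMDl !saMZl.
  by have [-> _ _ -> _] := b12_table K; rewrite scaler0 add0r scalerN scaleNr.
have muly : u ** b12_y K = u.2 0 0 *: b12_one K.
  rewrite {1}(b12_basis u) a0 scale0r add0r saMDl !saMZl.
  by have [_ -> -> _ _] := b12_table K; rewrite scaler0 addr0.
have [q0|q0] := eqVneq (u.2 0 0) 0; last first.
  by apply: (B12_ideal_scalar hI q0); rewrite -muly; apply: giMr.
have [q1|q1] := eqVneq (u.2 0 1) 0; last first.
  by apply: (@B12_ideal_scalar I (- u.2 0 1)); rewrite ?oppr_eq0 // -mulx; apply: giMr.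
by case: u0; rewrite (b12_basis u) a0 q0 q1 !scale0r !addr0.
Qed.

End JordanSimple.

(** * The centre of Gamma(A) *)

Section Center.
Variables (F : comNzRingType) (A : comAlgType F).

Definition gamma_scalar (a : A) : Gamma A := (a, 0).
Definition gamma_e1 : Gamma A := (0, (1, 0)).
Definition gamma_e2 : Gamma A := (0, (0, 1)).

Lemma gamma_scalarM a (u : Gamma A) :
  gamma_scalar a ** u = (a * u.1, (a * u.2.1, a * u.2.2)).
Proof. by case: u => b [c d]; apply: gamma_ext => /=; ring. Qed.

Lemma gamma_scalarMr a (u : Gamma A) : u ** gamma_scalar a = gamma_scalar a ** u.
Proof. by case: u => b [c d]; apply: gamma_ext => /=; ring. Qed.

(** The associators (z, e1, e2) and (z, e2, e1) have -b and c among their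
coordinates; these are the two equations used, and they determine b and c
even when 2 = 0. *)
Lemma gamma_central (z : Gamma A) : central z <-> z.2 = 0.
Proof.
case: z => a [b c]; split=> [[hz _]|/= [-> ->]].
  have [/(congr1 (fun u : Gamma A => u.2.1)) e _ _] := hz gamma_e1 gamma_e2.
  have [/(congr1 (fun u : Gamma A => u.2.2)) e' _ _] := hz gamma_e2 gamma_e1.
  have b0 : - b = 0 by apply: etrans e => /=; ring.
  have c0 : c = 0 by apply: etrans e' => /=; ring.
  by rewrite c0 -[b]opprK b0 oppr0.
split=> [x y|i j x].
  by case: x y => a1 [b1 c1] [a2 [b2 c2]]; split; apply: gamma_ext => /=; ring.
case: i.
  have -> : sa_pr true ((a, 0) : Gamma A) = 0 by [].
  by rewrite sa0M saM0 scaler0.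
by rewrite scale1r; apply: esym; apply: gamma_scalarMr.
Qed.

End Center.

Section Domain.
Variables (F : fieldType) (A : idomainAlgType F).
Implicit Types (u v z : Gamma A).

Lemma central_scalar z : central z -> z = gamma_scalar z.1.
Proof. by move/gamma_central; case: z => a p /= ->. Qed.

Lemma gamma_scalar_central (a : A) : central (gamma_scalar a : Gamma A).
Proof. exact/gamma_central. Qed.

Lemma gamma_scalar_eq0 (a : A) : gamma_scalar a = 0 -> a = 0.
Proof. by case. Qed.

Lemma gamma_scalar_inj (a : A) u : a != 0 -> gamma_scalar a ** u = 0 -> u = 0.
Proof.
move=> /negPf a0; rewrite gamma_scalarM => -[/eqP + /eqP + /eqP].
by rewrite !mulf_eq0 a0 /= => /eqP e1 /eqP e2 /eqP e3; apply: gamma_ext.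
Qed.

Lemma Gamma_center_domain : center_domain (Gamma A).
Proof.
split=> [|z w|z|z].
- exists (gamma_scalar 1); split; first exact: gamma_scalar_central.
    by move/gamma_scalar_eq0/eqP; rewrite oner_eq0.
  by move=> z _; rewrite gamma_scalarM !mul1r; case: z => ? [].
- move=> /central_scalar -> /central_scalar ->.
  have [->|a0] := eqVneq z.1 0; first by left.
  by move=> /(gamma_scalar_inj a0); right.
- by move/central_scalar=> ->.
- move=> /central_scalar -> a0 x; apply: gamma_scalar_inj.
  by apply/eqP => z0; apply: a0; rewrite z0.
Qed.

(** In a purely odd element (b, c), multiplication by e2 on the right extracts b
and by e1 on the left extracts c. *)
Lemma graded_ideal_scalar (I : Gamma A -> Prop) :
  graded_ideal I -> nonzero_set I -> exists2 a : A, a != 0 & I (gamma_scalar a).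
Proof.
move=> hI [u Iu u0]; have [a0|a0] := eqVneq u.1 0; last first.
  by exists u.1 => //; apply: (gi_pr hI false Iu).
have [b0|b0] := eqVneq u.2.1 0; last first.
  exists u.2.1 => //; have := gi_pr hI false (giMr hI (gamma_e2 A) Iu).
  by congr I; apply: gamma_ext; case: u {Iu u0 a0 b0} => a [b c] /=; ring.
have [c0|c0] := eqVneq u.2.2 0; last first.
  exists u.2.2 => //; have := gi_pr hI false (giMl hI (gamma_e1 A) Iu).
  by congr I; apply: gamma_ext; case: u {Iu u0 a0 b0 c0} => a [b c] /=; ring.
by case: u0; apply: gamma_ext.
Qed.

Lemma Gamma_prime : prime_sa (Gamma A).
Proof.
move=> I J hI hJ nI nJ.
have [a a0 Ia] := graded_ideal_scalar hI nI.
have [b b0 Jb] := graded_ideal_scalar hJ nJ.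
exists (gamma_scalar a), (gamma_scalar b); split=> //.
by move/(gamma_scalar_inj a0)/gamma_scalar_eq0/eqP; rewrite (negPf b0).
Qed.

End Domain.

(** * The localization of Gamma(A) at its centre *)

Lemma scaler_div_eq (K : fieldType) (V : lmodType K) (a b : K) (u v : V) :
  a != 0 -> b != 0 -> a^-1 *: u = b^-1 *: v <-> b *: u = a *: v.
Proof.
move=> a0 b0; split=> [/(canRL (scalerKV a0)) ->|/esym/(canRL (scalerK a0)) ->].
  by rewrite scalerA mulrC -scalerA scalerKV.
by rewrite scalerA [b^-1 * _]mulrC -scalerA scalerK.
Qed.

Lemma fraction_denominator (A : idomainType) (q : {fraction A}) :
  exists2 d : A, d != 0 & exists a : A, q * tofrac d = tofrac a.
Proof.
elim/quotW: q => x; exists (\d_x); first exact: denom_ratioP.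
exists (\n_x); unlock tofrac; rewrite -[LHS]FracField.pi_mul.
apply/eqmodP; rewrite /= FracField.equivfE.
by rewrite !numden_Ratio ?mulf_neq0 ?oner_neq0 ?denom_ratioP // !mulr1 mulrC.
Qed.

Section Localization.
Variables (F : fieldType) (A : idomainAlgType F).
Implicit Types (u v : Gamma A).

Let K := {fraction A}.
Let phi : {rmorphism F -> K} := @tofrac A \o in_alg A.
(* B(1,2) over K, regarded over F so that it can be compared with the
   localization of an F-superalgebra. *)
Let B : superalgebra F := restrict_scalars phi (B12 K).

Definition gamma_to_B12 u : B12 K :=
  (tofrac u.1, \row_i tofrac (if i == 0 then u.2.1 else u.2.2)).

Lemma gamma_to_B12_inj : injective gamma_to_B12.
Proof.
move=> u v [/eqP e1 /rowP e2]; have := e2 0; have := e2 1; rewrite !mxE /=.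
by move=> /eqP + /eqP; move: e1; rewrite !tofrac_eq => /eqP ? /eqP ? /eqP ?; apply: gamma_ext.
Qed.

Lemma gamma_to_B12_linear a u v :
  gamma_to_B12 (a *: u + v) = tofrac a%:A *: gamma_to_B12 u + gamma_to_B12 v.
Proof.
have tofracZ (x : A) : tofrac (a *: x) = tofrac a%:A * tofrac x.
  by rewrite -tofracM mulr_algl.
apply: b12_ext => /=; first by rewrite tofracD tofracZ.
by apply/rowP => i; rewrite !mxE; case: (i == 0); rewrite tofracD tofracZ.
Qed.

Lemma gamma_to_B12M u v : gamma_to_B12 (u ** v) = gamma_to_B12 u ** gamma_to_B12 v.
Proof.
case: u v => a [b c] [a' [b' c']]; apply: b12_ext => /=.
  by rewrite /b12_form !mxE /= !(tofracD, tofracN, tofracM).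
apply/rowP => i; rewrite !mxE; case: (i == 0);
  by rewrite !(tofracD, tofracM).
Qed.

Lemma gamma_to_B12_pr i u : gamma_to_B12 (sa_pr i u) = sa_pr i (gamma_to_B12 u).
Proof.
case: i; apply: b12_ext => //=.
by apply/rowP => i; rewrite !mxE; case: ifP.
Qed.

Lemma gamma_to_B12_scalar (a : A) u :
  gamma_to_B12 (gamma_scalar a ** u) = tofrac a *: gamma_to_B12 u.
Proof.
rewrite gamma_scalarM; apply: b12_ext => /=; first by rewrite tofracM.
by apply/rowP => i; rewrite !mxE -tofracM; case: ifP.
Qed.

Let hG := @Gamma_center_domain F A.
Let loc := localization hG.
Implicit Types s t : denom (Gamma A).

Lemma denomE s : val s = gamma_scalar (val s).1.
Proof. exact: central_scalar (@denom_central _ _ s). Qed.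

Lemma denom_scalar_neq0 s : (val s).1 != 0.
Proof.
by apply/eqP => s0; apply: (@denom_neq0 _ _ s); rewrite denomE s0.
Qed.

Lemma denom_frac_neq0 s : tofrac (val s).1 != 0.
Proof. by rewrite tofrac_eq0 denom_scalar_neq0. Qed.

Lemma gamma_to_B12_denom s u :
  gamma_to_B12 (val s ** u) = tofrac (val s).1 *: gamma_to_B12 u.
Proof. by rewrite {1}denomE gamma_to_B12_scalar. Qed.

(** Defined on the chosen representative of a class; loc_to_B12E says that every
representative gives the same value. *)
Definition loc_to_B12 (q : loc) : B :=
  (tofrac (val (repr (q : loc_type hG)).2).1)^-1 *:
     gamma_to_B12 (repr (q : loc_type hG)).1 : B12 K.

Lemma loc_to_B12E u s :
  loc_to_B12 (Defs.frac hG u s) = (tofrac (val s).1)^-1 *: gamma_to_B12 u :> B12 K.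
Proof.
rewrite /loc_to_B12; case e: (repr _) => [v t] /=.
have /(congr1 gamma_to_B12) := repr_frac e.
by rewrite !gamma_to_B12_denom => vu; apply/scaler_div_eq=> //; apply: denom_frac_neq0.
Qed.

Lemma loc_to_B12_linear : linear loc_to_B12.
Proof.
move=> a; apply: frac_common2 => x y s.
rewrite frac_scale frac_add [LHS]loc_to_B12E (loc_to_B12E x s) (loc_to_B12E y s).
rewrite gamma_to_B12_linear scalerDr scalerA mulrC -scalerA.
(* Scaling by a in B is, by definition, scaling by tofrac a%:A in B(1,2). *)
by [].
Qed.

HB.instance Definition _ :=
  GRing.isLinear.Build F loc B *:%R loc_to_B12 loc_to_B12_linear.

Lemma loc_to_B12M p q : loc_to_B12 (p ** q) = loc_to_B12 p ** loc_to_B12 q.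
Proof.
elim/fracW: p => x s; elim/fracW: q => y t; rewrite [_ ** _]loc_mulE [LHS]loc_to_B12E.
rewrite (loc_to_B12E x s) (loc_to_B12E y t) gamma_to_B12M.
have -> : (val (denom_mul hG s t)).1 = (val s).1 * (val t).1.
  by rewrite -[val (denom_mul _ _ _)]/(val s ** val t) {1}denomE gamma_scalarM.
by rewrite tofracM invfM -scalerA -(@saMZr _ (B12 K)) -(@saMZl _ (B12 K)).
Qed.

Lemma loc_to_B12_pr i q : loc_to_B12 (sa_pr i q) = sa_pr i (loc_to_B12 q).
Proof.
elim/fracW: q => x s; rewrite [sa_pr i _]loc_prE [LHS]loc_to_B12E.
by rewrite (loc_to_B12E x s) gamma_to_B12_pr -(@sa_prZ _ (B12 K)).
Qed.

Lemma loc_to_B12_inj : injective loc_to_B12.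
Proof.
elim/fracW=> x s; elim/fracW => y t; rewrite !loc_to_B12E.
move=> /(scaler_div_eq (V := B12 K) _ _ (denom_frac_neq0 s) (denom_frac_neq0 t)).
by rewrite -!gamma_to_B12_denom => /gamma_to_B12_inj; apply: fracE.
Qed.

(** The three coordinates of b have denominators d, d1, d2; the product
d * d1 * d2 serves as the common central denominator. *)
Lemma loc_to_B12_surj (b : B12 K) : exists q, loc_to_B12 q = b.
Proof.
have [d d0 [a e]] := fraction_denominator b.1.
have [d1 d10 [a1 e1]] := fraction_denominator (b.2 0 0).
have [d2 d20 [a2 e2]] := fraction_denominator (b.2 0 1).
pose s : Gamma A := gamma_scalar (d * d1 * d2).
have ds : `[< central s /\ s <> 0 >].
  apply/asboolP; split; first exact: gamma_scalar_central.
  by move/gamma_scalar_eq0/eqP; rewrite !mulf_eq0 (negPf d0) (negPf d10) (negPf d20).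
exists (Defs.frac hG ((a * d1 * d2, (a1 * d * d2, a2 * d * d1)) : Gamma A) (Denom ds)).
apply: etrans (loc_to_B12E _ _) _.
apply: (canLR (scalerK (V := B12 K) (denom_frac_neq0 (Denom ds)))) => /=.
apply: b12_ext => /=; first by rewrite !tofracM -e /GRing.scale /=; ring.
apply/rowP => i; rewrite !mxE; case: eqP => [->|ni].
  by rewrite !tofracM -e1; ring.
have -> : i = 1 by case: i ni => -[|[|//]] p ni; apply: val_inj => //; case: ni; apply: val_inj.
by rewrite !tofracM -e2; ring.
Qed.

Lemma Gamma_central_order : central_order (Gamma A) B.
Proof.
exists hG; exists loc_to_B12; last by split; [apply: loc_to_B12M|apply: loc_to_B12_pr].
have h b := cid (loc_to_B12_surj b).
exists (fun b => projT1 (h b)) => [q|b]; last exact: projT2 (h b).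
by apply: loc_to_B12_inj; apply: projT2 (h _).
Qed.

End Localization.

(** * The superalgebra of endomorphisms of a graded module *)

Section GradedEndomorphisms.
Variables (k : comNzRingType) (V : lmodType k) (p : bool -> V -> V).
Hypothesis p_linear : forall i, linear (p i).
Hypothesis p_sum : forall v, v = p false v + p true v.
Hypothesis p_p : forall i j v, p i (p j v) = if i == j then p j v else 0.

(** Linearity as a boolean predicate, so that endomorphisms form a subtype of the
module of functions and inherit its module structure. *)
Definition linear_pred : pred (V -> V) := fun f => `[< linear f >].

Lemma linear_pred_submod : submod_closed linear_pred.
Proof.
split=> [|a f g /asboolP lf /asboolP lg]; apply/asboolP => b u v.
  by rewrite scaler0 addr0.
change (a *: f (b *: u + v) + g (b *: u + v)
        = b *: (a *: f u + g u) + (a *: f v + g v)).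
rewrite lf lg !scalerDr !scalerA addrACA; congr (_ *: _ + _ + _).
exact: mulrC.
Qed.

HB.instance Definition _ :=
  GRing.isSubmodClosed.Build k (V -> V) linear_pred linear_pred_submod.

Definition endo : Type := {f : V -> V | linear_pred f}.
HB.instance Definition _ := SubType.on endo.
HB.instance Definition _ := [Choice of endo by <:].
HB.instance Definition _ := [SubChoice_isSubLmodule of endo by <:].

Implicit Types f g h : endo.

Lemma endo_linear f : linear (val f).
Proof. by case: f => f /= /asboolP. Qed.

Definition Endo (f : V -> V) (lf : linear f) : endo := Sub f (asboolT lf).

Lemma endoP f g : val f =1 val g -> f = g.
Proof. by move=> fg; apply/val_inj/funext. Qed.

Lemma endoZD a f g v : val (a *: f + g) v = a *: val f v + val g v.
Proof. by rewrite GRing.valD GRing.valZ. Qed.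

Lemma endo_comp_linear f g : linear (val f \o val g).
Proof. by move=> a u v; rewrite /= !endo_linear. Qed.

Definition endo_mul f g : endo := Endo (@endo_comp_linear f g).

Lemma endo_mulE f g v : val (endo_mul f g) v = val f (val g v).
Proof. by []. Qed.

(** The part of f that shifts degrees by i. *)
Definition endo_pr_fun (i : bool) f v : V :=
  p i (val f (p false v)) + p (~~ i) (val f (p true v)).

Lemma endo_pr_is_linear i f : linear (endo_pr_fun i f).
Proof.
move=> a u v; rewrite /endo_pr_fun !p_linear !endo_linear !p_linear.
by rewrite scalerDr addrACA.
Qed.

Definition endo_pr i f : endo := Endo (@endo_pr_is_linear i f).

Lemma p_0 i : p i 0 = 0.
Proof. by have := p_linear i (-1) 0 0; rewrite scaler0 addr0 scaleN1r addNr. Qed.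

Lemma endo0 f : val f 0 = 0.
Proof. by have := endo_linear f (-1) 0 0; rewrite scaler0 addr0 scaleN1r addNr. Qed.

(** The working form of endo_pr: on homogeneous vectors the parity component is
a single projection, which reduces all grading laws to addition in bool. *)
Lemma endo_pr_homog i f j v : val (endo_pr i f) (p j v) = p (i (+) j) (val f (p j v)).
Proof.
rewrite /= /endo_pr_fun !p_p.
by case: j => /=; rewrite endo0 p_0 ?addr0 ?add0r ?addbT ?addbF.
Qed.

Lemma endo_homog_ext f g :
  (forall j v, val f (p j v) = val g (p j v)) -> f = g.
Proof.
move=> fg; apply: endoP => v; rewrite (p_sum v) -[p false v]scale1r.
by rewrite !endo_linear !fg.
Qed.

Lemma endo_mul_linear f : linear (endo_mul f).
Proof.
by move=> a g h; apply: endoP => v; rewrite endoZD /= -endo_linear -endoZD.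
Qed.

Lemma endo_mul_linearl g : linear (fun f => endo_mul f g).
Proof. by move=> a f h; apply: endoP => v; rewrite endoZD /= -endoZD. Qed.

Lemma endo_pr_linear i : linear (endo_pr i).
Proof.
move=> a f g; apply: endo_homog_ext => j v.
by rewrite endoZD !endo_pr_homog endoZD p_linear.
Qed.

Lemma endo_pr_sum f : f = endo_pr false f + endo_pr true f.
Proof.
apply: endo_homog_ext => j v; rewrite -[endo_pr false f]scale1r endoZD scale1r.
rewrite !endo_pr_homog [LHS]p_sum.
by case: j => //=; rewrite addrC.
Qed.

Lemma endo_pr_pr i j f :
  endo_pr i (endo_pr j f) = if i == j then endo_pr j f else 0.
Proof.
apply: endo_homog_ext => l v; rewrite !endo_pr_homog p_p.
rewrite (inj_eq (@addIb l)); case: eqP => _; first by rewrite endo_pr_homog.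
by rewrite GRing.val0.
Qed.

Lemma endo_mul_graded i j f g :
  endo_pr (i (+) j) (endo_mul (endo_pr i f) (endo_pr j g))
    = endo_mul (endo_pr i f) (endo_pr j g).
Proof.
apply: endo_homog_ext => l v; rewrite !endo_pr_homog.
by rewrite endo_mulE !endo_pr_homog p_p -addbA eqxx.
Qed.

Definition End_sa : superalgebra k := Superalgebra endo_mul_linear
  endo_mul_linearl endo_pr_linear endo_pr_sum endo_pr_pr endo_mul_graded.

Lemma End_sa_assoc : associative_sa End_sa.
Proof.
move=> f g h; apply/eqP; rewrite /assoc subr_eq0; apply/eqP.
exact: endoP.
Qed.

End GradedEndomorphisms.

(** * Speciality of Gamma(A) through the Weyl algebra *)

(** Expanding the sums over parities and clearing the factor 1/2 leaves identities
with integer coefficients, which can be decided by normalization. *)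
Lemma plus_mulE (F : fieldType) (R : superalgebra F) (a b c : R) :
  (2%:R : F) != 0 ->
  2%:R *: c =
    (sa_pr true a ** sa_pr true b - sa_pr true b ** sa_pr true a)
    + (sa_pr true a ** sa_pr false b + sa_pr false b ** sa_pr true a)
    + (sa_pr false a ** sa_pr true b + sa_pr true b ** sa_pr false a)
    + (sa_pr false a ** sa_pr false b + sa_pr false b ** sa_pr false a) ->
  c = plus_mul a b.
Proof.
move=> two0 e; rewrite /plus_mul !big_bool /= expr0 expr1 !scale1r scaleN1r.
by rewrite addrA -e scalerK.
Qed.

(** Turns the action of F on A into a product in A, which ring can handle. *)
Lemma scale_as_mul (F : comNzRingType) (A : comAlgType F) (r : F) :
  exists d : A, forall x, r *: x = d * x.
Proof. by exists r%:A => x; rewrite mulr_algl. Qed.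

Section Weyl.
Variables (F : fieldType) (A : comAlgType F).

(* The sequence s stands for the formal power series sum_n (s n) t^n. *)
Let V : lmodType F := nat -> A.

Definition parity_pr (i : bool) (s : V) : V := fun n => if odd n == i then s n else 0.

Lemma parity_pr_linear i : linear (parity_pr i).
Proof.
move=> a s t; apply/funext => n.
change ((if odd n == i then a *: s n + t n else 0) = a *: parity_pr i s n + parity_pr i t n).
by rewrite /parity_pr; case: eqP; rewrite ?scaler0 ?addr0.
Qed.

Lemma parity_pr_sum s : s = parity_pr false s + parity_pr true s.
Proof.
apply/funext => n; change (s n = parity_pr false s n + parity_pr true s n).
by rewrite /parity_pr; case: odd; rewrite ?addr0 ?add0r.
Qed.

Lemma parity_pr_pr i j s :
  parity_pr i (parity_pr j s) = if i == j then parity_pr j s else 0.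
Proof.
have -> : (if i == j then parity_pr j s else 0) = fun n => if i == j then parity_pr j s n else 0.
  by case: eqP.
by apply/funext => n; rewrite /parity_pr; case: (odd n) i j => -[] [].
Qed.

Definition seq_End : superalgebra F :=
  End_sa parity_pr_linear parity_pr_sum parity_pr_pr.

(** Twice the derivation d/dt, so that its commutator with multiplication by t
is 2. *)
Definition deriv2 (s : V) : V := fun n => 2%:R * n.+1%:R * s n.+1.

(** Multiplication by t. *)
Definition shift (s : V) : V := fun n => if n is m.+1 then s m else 0.

(** The operator a + b X + c Y attached to u = (a, (b, c)). *)
Definition weyl_fun (u : Gamma A) (s : V) : V := fun n =>
  u.1 * s n + u.2.1 * deriv2 s n + u.2.2 * shift s n.

Lemma weyl_fun_linear u : linear (weyl_fun u).
Proof.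
move=> r s t; apply/funext => n.
change (weyl_fun u (r *: s + t) n = r *: weyl_fun u s n + weyl_fun u t n).
have [d dE] := scale_as_mul A r.
have sE m : (r *: s + t) m = d * s m + t m by rewrite -dE.
by case: n => [|n]; rewrite /weyl_fun /deriv2 /shift !sE dE; ring.
Qed.

Definition weyl (u : Gamma A) : plus_sa seq_End := Endo (@weyl_fun_linear u).

Lemma weyl_linear : linear weyl.
Proof.
move=> r u v; apply: endoP => s; rewrite endoZD; apply/funext => n.
change (weyl_fun (r *: u + v) s n = r *: weyl_fun u s n + weyl_fun v s n).
have [d dE] := scale_as_mul A r.
by rewrite /weyl_fun /= !dE; ring.
Qed.

HB.instance Definition _ :=
  GRing.isLinear.Build F (Gamma A) (plus_sa seq_End) *:%R weyl weyl_linear.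

Lemma weyl_pr i u : weyl (sa_pr i u) = sa_pr i (weyl u).
Proof.
apply: (endo_homog_ext parity_pr_sum) => j s; rewrite (endo_pr_homog parity_pr_linear parity_pr_pr).
apply/funext => n; rewrite /= /weyl_fun /deriv2 /shift /parity_pr.
case: n => [|n]; first by case: i j => [] [] /=; ring.
by case: i j => [] [] /=; case: (odd n) => /=; ring.
Qed.

(** After splitting into parities this is the commutator relation
X Y - Y X = 2; the terms XX and YY cancel. *)
Lemma weylM u v : (2%:R : F) != 0 -> weyl (u ** v) = weyl u ** weyl v.
Proof.
move=> two0.
apply: (plus_mulE (R := seq_End) two0); rewrite -!weyl_pr.
apply: endoP => s; apply/funext => n.
rewrite GRing.valZ !(GRing.valD, GRing.valN).
pose W a b := weyl_fun a (weyl_fun b s) n.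
change (2%:R *: weyl_fun (u ** v) s n =
  (W (sa_pr true u) (sa_pr true v) - W (sa_pr true v) (sa_pr true u))
  + (W (sa_pr true u) (sa_pr false v) + W (sa_pr false v) (sa_pr true u))
  + (W (sa_pr false u) (sa_pr true v) + W (sa_pr true v) (sa_pr false u))
  + (W (sa_pr false u) (sa_pr false v) + W (sa_pr false v) (sa_pr false u))).
rewrite scaler_nat -mulr_natl /W /weyl_fun /deriv2 /shift.
case: u v {W} => a [b c] [a' [b' c']].
(* Two shifts look back two places: the coefficients 0 and 1 are boundary
   cases. *)
by case: n => [|[|n]] /=; ring.
Qed.

(** The series 1 and t detect a, c and 2b. *)
Lemma weyl_inj : (2%:R : F) != 0 -> injective weyl.
Proof.
move=> two0; apply: raddf_inj => u u0.
have ev s n : weyl_fun u s n = 0 by rewrite -[LHS]/(val (weyl u) s n) u0.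
have e0 : u.1 = 0.
  rewrite -(ev (fun n => (n == 0)%:R) 0) /weyl_fun /deriv2 /shift /=; ring.
have e2 : u.2.2 = 0.
  rewrite -(ev (fun n => (n == 0)%:R) 1) /weyl_fun /deriv2 /shift /=; ring.
have e1 : 2%:R * u.2.1 = 0.
  rewrite -(ev (fun n => (n == 1)%:R) 0) /weyl_fun /deriv2 /shift /=; ring.
apply: gamma_ext => //; apply: (scalerI two0); rewrite scaler0 -e1.
by rewrite scaler_nat mulr_natl.
Qed.

Lemma Gamma_special : (2%:R : F) != 0 -> special (Gamma A).
Proof.
move=> two0; exists seq_End; first exact: End_sa_assoc.
exists weyl; first exact: weyl_inj.
by split=> [x y|i x]; [apply: weylM | apply: weyl_pr].
Qed.

End Weyl.

Theorem proposition3 (F : fieldType) (A : idomainAlgType F) :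
  (jordan (B12 {fraction A}) /\ simple_sa (B12 {fraction A})) /\
  central_order (Gamma A)
    (restrict_scalars (@tofrac A \o in_alg A) (B12 {fraction A})) /\
  prime_sa (Gamma A) /\
  ((2%:R : F) != 0 -> special (Gamma A)).
Proof.
split; first by split; [apply: B12_jordan | apply: B12_simple].
split; first exact: Gamma_central_order.
by split; [apply: Gamma_prime | apply: Gamma_special].
Qed.
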